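(* If a dynamical system $(X,f)$ has the weak asymptotic average shadowing property, then it also has the average shadowing property.
   Context: A dynamical system $(X,f)$ is a compact metric space $(X,d)$ together with a continuous map $f\colon X\to X$ (not assumed surjective). A sequence $\{x_i\}_{i=0}^\infty\subset X$ is: a $\delta$-average-pseudo-orbit of $f$ if there is $N>0$ such that $\frac1n\sum_{i=0}^{n-1}d(f(x_{i+k}),x_{i+k+1})<\delta$ for all $n\ge N$ and all integers $k\ge0$; an asymptotic average pseudo-orbit of $f$ if $\lim_{n\to\infty}\frac1n\sum_{i=0}^{n-1}d(f(x_i),x_{i+1})=0$. $(X,f)$ has the average shadowing property if for every $\varepsilon>0$ there is $\delta>0$ such that for every $\delta$-average-pseudo-orbit $\{x_i\}_{i=0}^\infty$ there is $z\in X$ with $\limsup_{n\to\infty}\frac1n\sum_{i=0}^{n-1}d(f^i(z),x_i)<\varepsilon$. $(X,f)$ has the weak asymptotic average shadowing property if for every $\varepsilon>0$ and every asymptotic average pseudo-orbit $\{x_i\}_{i=0}^\infty$ there is $z\in X$ with $\limsup_{n\to\infty}\frac1n\sum_{i=0}^{n-1}d(f^i(z),x_i)<\varepsilon$. *)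

(* Defs.v *)
From HB Require Import structures.
From mathcomp Require Import all_boot all_order all_algebra.
From mathcomp Require Import all_classical all_reals all_analysis.

Set Implicit Arguments.
Unset Strict Implicit.
Unset Printing Implicit Defensive.

Import Order.TTheory GRing.Theory Num.Theory.
Import numFieldNormedType.Exports.

Local Open Scope classical_set_scope.
Local Open Scope ring_scope.

(* The library's [arithmetic_mean] is shifted by one ([n.+1] terms at index
   [n]). Here index [n] has [n] terms; the value at [n = 0] is [0]. *)
Definition average (R : realType) (u : nat -> R) (n : nat) : R :=
  n%:R^-1 * \sum_(i < n) u i.

Section AverageShadowing.
Context {R : realType} {X : metricType R}.
Implicit Types (f : X -> X) (x : nat -> X).

Definition average_pseudo_orbit f (delta : R) x : Prop :=
  exists2 N : nat, (0 < N)%N &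
    forall n k : nat, (N <= n)%N ->
      average (fun i => mdist (f (x (i + k)%N)) (x (i + k).+1)) n < delta.

Definition asymptotic_average_pseudo_orbit f x : Prop :=
  average (fun i => mdist (f (x i)) (x i.+1)) n @[n --> \oo] --> (0 : R).

(* The upper limit is taken in the extended reals, where it always exists. *)
Definition average_shadows f (eps : R) (z : X) x : Prop :=
  (limn_esup (fun n => (average (fun i => mdist (iter i f z) (x i)) n)%:E)
   < eps%:E)%E.

Definition average_shadowing_property f : Prop :=
  forall eps : R, 0 < eps ->
    exists2 delta : R, 0 < delta &
      forall x, average_pseudo_orbit f delta x ->
        exists z : X, average_shadows f eps z x.

Definition weak_asymptotic_average_shadowing_property f : Prop :=
  forall eps : R, 0 < eps ->
    forall x, asymptotic_average_pseudo_orbit f x ->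
      exists z : X, average_shadows f eps z x.

End AverageShadowing.

(* Main.v *)
Require Import Defs.
From HB Require Import structures.
From mathcomp Require Import all_boot all_order all_algebra.
From mathcomp Require Import all_classical all_reals all_analysis.
From mathcomp Require Import zify lra.

Import Order.TTheory GRing.Theory Num.Theory.
Import numFieldNormedType.Exports.

Local Open Scope classical_set_scope.
Local Open Scope ring_scope.

(** Suppose that average shadowing fails at the scale [eps]. Then for every [m]
    there is a [1/(m+1)]-average-pseudo-orbit [x m] that no point shadows on
    average within [eps]. The idea is to run through longer and longer initial
    segments of [x 0], [x 1], [x 2], and so on, one after the other, and to
    apply the weak asymptotic property to the resulting sequence [y].

    The lengths can be chosen because failure of shadowing is visible in
    bounded time: by compactness ([uniform_escape_time]), for every [t] there
    is [L] such that every orbit has, at some time [n] with [t < n <= L], an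
    average distance to [x m] larger than [eps / 2]. If the [m]-th segment
    starts at time [t] and has length at least [L], then a point [z] is
    compared, after time [t], with [x m] along the orbit of [iter t f z]; since
    [n > t], the part before [t] takes at most half of the average at time
    [t + n], which is thus larger than [eps / 4]. As this happens in every
    segment, no point shadows [y] within [eps / 4].

    On the other hand [y] is an asymptotic average pseudo-orbit
    ([average_blocks_cvg0]). The [m]-th segment contributes an average error of
    at most [1/(m+1)], apart from an initial stretch whose length [N m] depends
    on [x m] only and from one jump to the next segment. All individual errors
    are bounded by the diameter, so the initial stretch and the past become
    negligible when the segment before is long compared with both; this only
    asks for even longer segments. *)

(** * Averages and upper limits *)

Lemma limn_esup_lt_near (R : realType) (u : nat -> \bar R) (c : \bar R) :
  (limn_esup u < c)%E -> \forall n \near \oo, (u n < c)%E.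
Proof.
move=> /ereal_inf_lt[_ [V Voo <-]] supc; apply: filterS Voo => n Vn.
by apply: le_lt_trans supc; apply: ereal_sup_ubound; exists n.
Qed.

Lemma limn_esup_le_near (R : realType) (u : nat -> \bar R) (c : \bar R) :
  (\forall n \near \oo, (u n <= c)%E) -> (limn_esup u <= c)%E.
Proof.
move=> uc; apply: (@le_trans _ _ (ereal_sup (u @` [set n | (u n <= c)%E]))).
  by apply: ereal_inf_lbound; exists [set n | (u n <= c)%E].
by apply: ge_ereal_sup => _ [n /= unc <-].
Qed.

Lemma lt_average (R : realType) (u : nat -> R) (c : R) (n : nat) :
  (0 < n)%N -> (c < average u n) = (c * n%:R < \sum_(i < n) u i).
Proof. by move=> n0; rewrite /average mulrC ltr_pdivlMr// ltr0n. Qed.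

Lemma average_lt (R : realType) (u : nat -> R) (c : R) (n : nat) :
  (0 < n)%N -> (average u n < c) = (\sum_(i < n) u i < c * n%:R).
Proof. by move=> n0; rewrite /average mulrC ltr_pdivrMr// ltr0n. Qed.

Lemma ler_sum_bound (R : realType) (u : nat -> R) (D : R) (n : nat) :
  (forall i, u i <= D) -> \sum_(i < n) u i <= n%:R * D.
Proof.
move=> uD; rewrite mulr_natl -[n in D *+ n]card_ord -sumr_const.
exact: ler_sum.
Qed.

Lemma sum_ordD (R : realType) (u : nat -> R) (t n : nat) :
  \sum_(i < t + n) u i = \sum_(i < t) u i + \sum_(i < n) u (t + i)%N.
Proof. by rewrite big_split_ord. Qed.

(** * Uniformity from compactness *)

Section Compactness.
Context {R : realType} {X : metricType R}.
Implicit Types (f : X -> X) (x : nat -> X) (z : X).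

Lemma continuous_mdist_l (a : X) : continuous (fun z : X => mdist z a).
Proof.
move=> z; apply/cvgrPdist_lt => e e0.
have := @nbhsx_ballx _ _ z e e0; rewrite ballEmdist; apply: filterS => w /= zw.
rewrite ltr_norml.
have := metric_triangle z w a; have := metric_triangle w z a.
rewrite (metric_sym w z); lra.
Qed.

(** The bound is taken in [nat] so that the growth conditions on breakpoints
    below are statements about natural numbers. *)
Lemma compact_mdist_bounded : compact [set: X] ->
  exists D : nat, forall a b : X, mdist a b <= D%:R.
Proof.
move=> /compact_near_coveringP cX.
have [[a0 _]|X0] := pselect (exists a : X, True); last first.
  by exists 0%N => a; exfalso; apply: X0; exists a.
have : \forall n \near \oo, [set: X] `<=` (fun a => mdist a a0 <= n%:R).
  apply: (cX nat \oo (fun n a => mdist a a0 <= n%:R)) => a _.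
  exists ([set b | mdist b a0 < mdist a a0 + 1],
          [set n : nat | mdist a a0 + 1 <= n%:R]) => /=.
    split; last exact: nbhs_infty_ger.
    apply: (cvgr_lt (mdist a a0)); first exact: continuous_mdist_l.
    by rewrite ltrDl.
  by move=> [b n] /= [ba an]; apply: le_trans an; exact: ltW.
move=> [n _ /(_ n (leqnn n)) bd]; exists (n + n)%N => a b.
apply: (le_trans (metric_triangle a a0 b)); rewrite natrD (metric_sym a0).
by apply: lerD; exact: bd.
Qed.

Lemma continuous_average_mdist f x n : continuous f ->
  continuous (fun z => average (fun i => mdist (iter i f z) (x i)) n).
Proof.
move=> cf z; apply: cvgMl_tmp.
have iterc i : continuous (iter i f).
  elim: i => [|i ih] w; first exact: cvg_id.
  exact: (@continuous_comp _ _ _ (iter i f) f w (ih w) (cf _)).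
elim: n => [|n ih].
  by under eq_fun do rewrite big_ord0; rewrite big_ord0; exact: cvg_cst.
under eq_fun do rewrite big_ord_recr /=; rewrite big_ord_recr /=.
apply: cvgD => //.
apply: (@continuous_comp _ _ _ (iter n f) (fun w => mdist w (x n)) z).
  exact: iterc.
exact: continuous_mdist_l.
Qed.

(** If the upper limit of the averages at [z] is at least [eps], some late
    average exceeds [c]. That average is continuous in the starting point, so
    the same time serves a neighbourhood of [z], and finitely many
    neighbourhoods suffice. *)
Lemma uniform_escape_time f x (c eps : R) (t : nat) :
  compact [set: X] -> continuous f -> c < eps ->
  (forall z, ~ average_shadows f eps z x) ->
  exists L : nat, forall z, exists n : nat,
    [/\ (t < n)%N, (n <= L)%N &
        c < average (fun i => mdist (iter i f z) (x i)) n].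
Proof.
move=> /compact_near_coveringP cX cf ceps nox.
pose P L z := exists n : nat, [/\ (t < n)%N, (n <= L)%N &
        c < average (fun i => mdist (iter i f z) (x i)) n].
suff [L _ /(_ L (leqnn L)) PL] : \forall L \near \oo, [set: X] `<=` P L.
  by exists L => z; exact: PL.
apply: cX => z _.
have [n tn cn] : exists2 n, (t < n)%N &
    c < average (fun i => mdist (iter i f z) (x i)) n.
  apply: contrapT => no; apply: (nox z).
  apply: (@le_lt_trans _ _ c%:E); last by rewrite lte_fin.
  apply: limn_esup_le_near; exists t.+1 => // n /= tn.
  by rewrite lee_fin leNgt; apply/negP => cn; apply: no; exists n.
exists ([set w | c < average (fun i => mdist (iter i f w) (x i)) n],
        [set L : nat | (n <= L)%N]) => /=.
  split; last by exists n.
  exact: (cvgr_gt _ (@continuous_average_mdist f x n cf z)).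
by move=> [w L] /= [cw nL]; exists n.
Qed.

End Compactness.

(** * Concatenation of blocks *)

(** The length of a block is dictated by the time at which it starts, hence by
    all previous lengths: breakpoints can only be chosen one after the other. *)
Lemma recursive_breakpoints (P : nat -> nat -> nat -> Prop) :
  (forall m t, exists t', P m t t') ->
  exists2 T : nat -> nat, T 0%N = 0%N & forall m, P m (T m) (T m.+1).
Proof.
move=> exP; have [g gP] := choice (fun mt : nat * nat => exP mt.1 mt.2).
exists (fix T m := if m is k.+1 then g (k, T k) else 0%N) => // m.
exact: (gP (m, _)).
Qed.

Section Concatenation.
Context (T : nat -> nat) (T0 : T 0%N = 0%N) (Tlt : forall m, (T m < T m.+1)%N).

Lemma breakpoint_mono m k : (m <= k)%N -> (T m <= T k)%N.
Proof.
by move=> mk; apply: (homo_leq leqnn leq_trans _ mk) => i; exact: ltnW.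
Qed.

Lemma breakpoint_ge m : (m <= T m)%N.
Proof. by elim: m => // m ih; exact: leq_ltn_trans (Tlt m). Qed.

Lemma breakpoint_block n : exists m, (T m <= n < T m.+1)%N.
Proof.
elim: n => [|n [m /andP[mn nm]]].
  by exists 0%N; have := Tlt 0; rewrite T0.
have [nm1|] := ltnP n.+1 (T m.+1); first by exists m; rewrite nm1 andbT ltnW.
by exists m.+1; have := Tlt m.+1; lia.
Qed.

Lemma concatenate_blocks (X : Type) (x : nat -> nat -> X) :
  exists y : nat -> X,
    forall m j, (T m + j < T m.+1)%N -> y (T m + j)%N = x m j.
Proof.
have [b bP] := choice breakpoint_block.
exists (fun n => x (b n) (n - T (b n))%N) => m j jm.
suff -> : b (T m + j)%N = m by rewrite addKn.
have /andP[lo hi] := bP (T m + j)%N.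
have [bm|mb|//] := ltngtP (b (T m + j)%N) m.
- by have := breakpoint_mono _ _ bm; lia.
- by have := breakpoint_mono _ _ mb; lia.
Qed.

(** Here [e] is the sequence of errors. The bound on partial sums inside a block
    is what a [1/(m+1)]-average-pseudo-orbit gives: up to time [N m] the errors
    are only known to be at most [D]. The error at the last time of a block is
    excluded from it, being the jump to the next block. The growth condition
    makes the past [T m], the stretch [N m], the jump and the next stretch
    [N m.+1], with every error counted as [D], add up to at most
    [T m.+1 / m.+1]; including [N m.+1] keeps the average small also shortly
    after the breakpoint [T m.+1]. *)
Lemma average_blocks_cvg0 (R : realType) (e : nat -> R) (D : nat)
    (N : nat -> nat) :
  (forall i, 0 <= e i <= D%:R) ->
  (forall m j, (T m + j < T m.+1)%N ->
    \sum_(i < j) e (T m + i)%N <= j%:R / m.+1%:R + (N m * D)%:R) ->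
  (forall m, (m.+1 * (D * (T m + N m + N m.+1 + 1)) <= T m.+1)%N) ->
  average e n @[n --> \oo] --> (0 : R).
Proof.
move=> eD eb Tb.
have e0 i : 0 <= e i by case/andP: (eD i).
have eleD i : e i <= D%:R by case/andP: (eD i).
have Tb' m : (D * (T m + N m + N m.+1 + 1))%:R <= (T m.+1)%:R / m.+1%:R :> R.
  by rewrite ler_pdivlMr ?ltr0n// -natrM ler_nat mulnC.
(* Reserving room for the term in [N m.+1] lets the next block absorb its
   initial stretch. *)
have whole m :
    \sum_(i < T m.+1) e i <= 2 * (T m.+1)%:R / m.+1%:R - (N m.+1 * D)%:R.
  (* The last index [T m + j] of the block carries the jump. *)
  have [j Tj] : exists j, T m.+1 = (T m + j + 1)%N.
    by exists (T m.+1 - T m - 1)%N; have := Tlt m; lia.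
  rewrite [in X in X <= _]Tj !sum_ordD big_ord1 addn0.
  have h1 := @ler_sum_bound _ e D%:R (T m) eleD.
  have h2 := eb m j; rewrite Tj addn1 ltnS leqnn in h2; have {}h2 := h2 isT.
  have h3 := eleD (T m + j)%N.
  have h4 : j%:R / m.+1%:R <= (T m.+1)%:R / m.+1%:R :> R.
    by rewrite ler_pM2r ?invr_gt0 ?ltr0n// ler_nat Tj; lia.
  have h5 := Tb' m; rewrite natrM !natrD in h5.
  rewrite -mulrA; move: h1 h2 h3 h4 h5; rewrite !natrM !mulrDr mulr1.
  rewrite ![_ * D%:R]mulrC.
  by set q := (T m.+1)%:R / _; set r := j%:R / _; lra.
have partial m n : (T m.+1 <= n)%N -> \sum_(i < n) e i <= 3 * n%:R / m.+1%:R.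
  move=> Tn; have [[|k] /andP[kn nk]] := breakpoint_block n.
    by have := breakpoint_mono 1 m.+1 isT; lia.
  have mk : (m <= k)%N.
    rewrite leqNgt; apply/negP => km.
    by have := breakpoint_mono k.+2 m.+1 km; lia.
  have [j nj] : exists j, n = (T k.+1 + j)%N by exists (n - T k.+1)%N; lia.
  rewrite [in X in X <= _]nj sum_ordD.
  have h1 := whole k.
  have h2 : \sum_(i < j) e (T k.+1 + i)%N <= _ := eb k.+1 j _.
  rewrite -nj in h2; have {}h2 := h2 nk.
  have h3 : j%:R / k.+2%:R <= n%:R / m.+1%:R :> R.
    by rewrite ler_pM ?ler_nat ?invr_ge0 ?ler0n// ?lef_pV2 ?posrE ?ltr0n//;
      rewrite ?ler_nat; lia.
  have h4 : (T k.+1)%:R / k.+1%:R <= n%:R / m.+1%:R :> R.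
    by rewrite ler_pM ?ler_nat ?invr_ge0 ?ler0n// ?lef_pV2 ?posrE ?ltr0n//;
      rewrite ?ler_nat; lia.
  move: h1 h2 h3 h4; rewrite -!(mulrA _ _ _^-1).
  set p := n%:R / _; set q := (T k.+1)%:R / _; set r := j%:R / _; lra.
apply/cvgrPdist_lt => eps eps0.
have [m mP] : exists m : nat, 3 / m.+1%:R < eps.
  exists (Num.bound (3 / eps)); rewrite ltr_pdivrMr ?ltr0n// -ltr_pdivrMl//.
  have := @archi_boundP _ (3 / eps); rewrite mulrC => /(_ _)/lt_trans -> //.
    by rewrite mulr_ge0// invr_ge0 ltW.
  by rewrite ltr_nat.
exists (T m.+1) => // n /= Tn.
have n0 : (0 < n)%N by have := Tlt m; lia.
rewrite sub0r normrN ger0_norm; last first.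
  by rewrite mulr_ge0// ?invr_ge0 ?ler0n// sumr_ge0.
rewrite average_lt//; apply: (le_lt_trans (partial m n Tn)).
by rewrite mulrAC ltr_pM2r ?ltr0n.
Qed.

End Concatenation.

(** * From asymptotic to average pseudo-orbits *)

Theorem theorem4p1 (R : realType) (X : metricType R) (f : X -> X)
    (compactX : compact [set: X]) (continuous_f : continuous f)
    (waasp : weak_asymptotic_average_shadowing_property f) :
  average_shadowing_property f.
Proof.
move=> eps eps0; apply: contrapT => noasp.
have [D DP] := @compact_mdist_bounded _ X compactX.
have /choice[xN xNP] : forall m : nat, exists p : (nat -> X) * nat,
    (forall j, \sum_(i < j) mdist (f (p.1 i)) (p.1 i.+1)
                <= j%:R / m.+1%:R + (p.2 * D)%:R) /\
    (forall z, ~ average_shadows f eps z p.1).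
  move=> m; apply: contrapT => nox; apply: noasp.
  exists m.+1%:R^-1; first by rewrite invr_gt0 ltr0n.
  move=> x [N N0 xN]; apply: contrapT => noz; apply: nox.
  exists (x, N); split => [j|z xz] /=; last by apply: noz; exists z.
  (* From time [N] on the average error is below [1/(m+1)]; before, each error
     is at most the diameter. *)
  have [Nj|jN] := leqP N j.
    have := xN j 0%N Nj; under eq_fun do rewrite addn0.
    rewrite average_lt; last exact: leq_trans Nj.
    rewrite mulrC => /ltW/le_trans; apply; rewrite lerDl ler0n//.
  pose e i := mdist (f (x i)) (x i.+1).
  apply: (le_trans (@ler_sum_bound _ e D%:R j (fun i => DP _ _))).
  rewrite -natrM -[leLHS]add0r lerD// ?divr_ge0 ?ler0n//.
  by rewrite ler_nat leq_mul2r ltnW ?orbT.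
pose x m := (xN m).1; pose N m := (xN m).2.
have [T T0 TP] : exists2 T : nat -> nat, T 0%N = 0%N & forall m,
    [/\ (T m < T m.+1)%N,
        (m.+1 * (D * (T m + N m + N m.+1 + 1)) <= T m.+1)%N &
        forall z, exists n : nat, [/\ (T m < n)%N, (T m + n <= T m.+1)%N &
          eps / 2 < average (fun i => mdist (iter i f z) (x m i)) n]].
  apply: (@recursive_breakpoints (fun m t t' => [/\ (t < t')%N,
        (m.+1 * (D * (t + N m + N m.+1 + 1)) <= t')%N &
        forall z, exists n : nat, [/\ (t < n)%N, (t + n <= t')%N &
          eps / 2 < average (fun i => mdist (iter i f z) (x m i)) n]])).
  move=> m t.
  have [||L LP] :=
    @uniform_escape_time _ _ f (x m) (eps / 2) eps t compactX continuous_f.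
  - lra.
  - exact: (xNP m).2.
  exists (t + L + m.+1 * (D * (t + N m + N m.+1 + 1)) + 1)%N; split; try lia.
  by move=> z; have [n [tn nL cn]] := LP z; exists n; split => //; lia.
have Tlt m : (T m < T m.+1)%N by case: (TP m).
have [y yP] := @concatenate_blocks T T0 Tlt _ x.
have yaapo : asymptotic_average_pseudo_orbit f y.
  apply: (@average_blocks_cvg0 T T0 Tlt _ _ D N).
  - by move=> i; rewrite mdist_ge0 DP.
  - move=> m j jm; apply: le_trans ((xNP m).1 j).
    apply: ler_sum => i _; have ij := ltn_ord i.
    by rewrite -addnS !yP//; lia.
  - by move=> m; case: (TP m).
have [|z /limn_esup_lt_near[M _ Mz]] := waasp (eps / 4) _ y yaapo.
  lra.
have [_ _ /(_ (iter (T M) f z))[n [Tn nT]]] := TP M.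
rewrite lt_average; last by lia.
have := Mz (T M + n)%N (leq_trans (breakpoint_ge T Tlt M) (leq_addr _ _)).
rewrite /= lte_fin average_lt; last by lia.
rewrite (sum_ordD _ (fun i => mdist (iter i f z) (y i))) natrD.
have -> : \sum_(i < n) mdist (iter (T M + i) f z) (y (T M + i)%N) =
          \sum_(i < n) mdist (iter i f (iter (T M) f z)) (x M i).
  apply: eq_bigr => i _; have ij := ltn_ord i.
  by rewrite [in iter _ _ _]addnC iterD yP//; lia.
have s0 : 0 <= \sum_(i < T M) mdist (iter i f z) (y i).
  by apply: sumr_ge0 => i _; exact: mdist_ge0.
(* The time [n] spent near [x M] is at least the whole past [T M], so an average
   above [eps / 2] over [n] steps is at least [eps / 4] over [T M + n] steps. *)
have : (T M)%:R * eps <= n%:R * eps by rewrite ler_pM2r// ler_nat ltnW.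
lra.
Qed.
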